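(* Let $\mathbb{F}$ be a field of characteristic $0$. For every finite group $G$ there exists a finite-dimensional idempotent evolution algebra $\mathcal{E}$ over $\mathbb{F}$ such that $\mathrm{Aut}(\mathcal{E})\cong G$.
   Context: An $n$-dimensional evolution algebra over a field $\mathbb{F}$ is a (not necessarily associative) commutative $\mathbb{F}$-algebra $\mathcal{E}$ that has a vector space basis $e_1,\dots,e_n$ (called a natural basis) with $e_ie_j=0$ for all $i\ne j$. The structure matrix of $\mathcal{E}$ with respect to this natural basis is the $n\times n$ matrix $A=(a_{ij})$ over $\mathbb{F}$ determined by $e_i^2=\sum_{j=1}^n a_{ji}e_j$ for $1\le i\le n$. The algebra $\mathcal{E}$ is called idempotent if $\mathcal{E}^2=\mathcal{E}$, where $\mathcal{E}^2$ is the linear span of all products; equivalently, $A$ is nonsingular. $\mathrm{Aut}(\mathcal{E})$ denotes the group of $\mathbb{F}$-algebra automorphisms of $\mathcal{E}$. *)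

(* Defs.v *)
From HB Require Import structures.
From mathcomp Require Import all_boot all_order all_fingroup all_algebra.
From mathcomp Require Import boolp.

Set Implicit Arguments.
Unset Strict Implicit.
Unset Printing Implicit Defensive.

Import GRing.Theory.
Local Open Scope ring_scope.

(* Finite-dimensional commutative algebras that are neither assumed
   associative nor unital; MathComp's algType is associative and unital. *)
HB.mixin Record Vector_isCommNaAlg (F : fieldType) E of Vector F E := {
  namul : E -> E -> E;
  namulC : commutative namul;
  namulDl : left_distributive namul +%R;
  namulZl : forall (a : F) (x y : E), namul (a *: x) y = a *: namul x y
}.

#[short(type="commNaAlgType")]
HB.structure Definition CommNaAlg (F : fieldType) :=
  {E of Vector_isCommNaAlg F E & Vector F E}.

Notation "x ** y" := (namul x y) (at level 40, left associativity) : ring_scope.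

Definition natural_basis (F : fieldType) (E : commNaAlgType F) (n : nat)
    (e : n.-tuple E) : Prop :=
  basis_of fullv e /\ forall i j : 'I_n, i != j -> tnth e i ** tnth e j = 0.

Definition evolution_algebra (F : fieldType) (E : commNaAlgType F) : Prop :=
  exists (n : nat) (e : n.-tuple E), natural_basis e.

(* Membership in E^2, the linear span of all the products x ** y; a span is
   formed of finite linear combinations, so finite lists of products suffice. *)
Definition in_square (F : fieldType) (E : commNaAlgType F) (v : E) : Prop :=
  exists s : seq (E * E), v \in <<[seq p.1 ** p.2 | p <- s]>>%VS.

Definition idempotent_algebra (F : fieldType) (E : commNaAlgType F) : Prop :=
  forall v : E, in_square v.

Definition algebra_automorphism (F : fieldType) (E : commNaAlgType F)
    (f : 'End(E)) : Prop :=
  bijective f /\ {morph f : x y / x ** y}.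

(* Boolean reflection lets algAut E inherit the choiceType structure that
   groupType requires. *)
Record algAut (F : fieldType) (E : commNaAlgType F) : Type := AlgAut {
  algAut_val :> 'End(E);
  _ : `[< algebra_automorphism algAut_val >]
}.

HB.instance Definition _ (F : fieldType) (E : commNaAlgType F) :=
  [isSub for @algAut_val F E].
HB.instance Definition _ (F : fieldType) (E : commNaAlgType F) :=
  [Choice of algAut E by <:].

Lemma algAutP (F : fieldType) (E : commNaAlgType F) (f : algAut E) :
  algebra_automorphism f.
Proof. exact: asboolW (valP f). Qed.

Lemma algAut_lker0 (F : fieldType) (E : commNaAlgType F) (f : algAut E) :
  lker f == 0%VS.
Proof. by apply/lker0P; apply: bij_inj; case: (algAutP f). Qed.

Lemma algAut_id_subproof (F : fieldType) (E : commNaAlgType F) :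
  `[< @algebra_automorphism F E \1%VF >].
Proof.
apply/asboolP; split; last by move=> x y; rewrite !id_lfunE.
by exists (\1%VF : 'End(E)) => x; rewrite !id_lfunE.
Qed.

Lemma algAut_comp_subproof (F : fieldType) (E : commNaAlgType F)
    (f g : algAut E) : `[< algebra_automorphism (f \o g)%VF >].
Proof.
case: (algAutP f) (algAutP g) => [bf mf] [bg mg]; apply/asboolP; split.
  by apply: (eq_bij (bij_comp bf bg)) => x; rewrite comp_lfunE.
by move=> x y; rewrite !comp_lfunE mg mf.
Qed.

Lemma algAut_inv_subproof (F : fieldType) (E : commNaAlgType F)
    (f : algAut E) : `[< algebra_automorphism (f^-1)%VF >].
Proof.
have kf := algAut_lker0 f; have [_ mf] := algAutP f.
have fK := lker0_lfunK kf; have fVK := lker0_lfunVK kf.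
apply/asboolP; split; first by exists f.
by move=> x y; rewrite -{1}(fVK x) -{1}(fVK y) -mf fK.
Qed.

Definition algAut_one (F : fieldType) (E : commNaAlgType F) : algAut E :=
  AlgAut (algAut_id_subproof E).
Definition algAut_mul (F : fieldType) (E : commNaAlgType F)
    (f g : algAut E) : algAut E := AlgAut (algAut_comp_subproof f g).
Definition algAut_inv (F : fieldType) (E : commNaAlgType F)
    (f : algAut E) : algAut E := AlgAut (algAut_inv_subproof f).

Lemma algAut_mulA (F : fieldType) (E : commNaAlgType F) :
  associative (@algAut_mul F E).
Proof. by move=> f g h; apply: val_inj; apply: comp_lfunA. Qed.

Lemma algAut_mul1 (F : fieldType) (E : commNaAlgType F) :
  left_id (algAut_one E) (@algAut_mul F E).
Proof. by move=> f; apply: val_inj; apply: comp_lfun1l. Qed.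

Lemma algAut_mulr1 (F : fieldType) (E : commNaAlgType F) :
  right_id (algAut_one E) (@algAut_mul F E).
Proof. by move=> f; apply: val_inj; apply: comp_lfun1r. Qed.

Lemma algAut_mulV (F : fieldType) (E : commNaAlgType F) :
  left_inverse (algAut_one E) (@algAut_inv F E) (@algAut_mul F E).
Proof. by move=> f; apply: val_inj; apply: lker0_compVf (algAut_lker0 f). Qed.

Lemma algAut_mulrV (F : fieldType) (E : commNaAlgType F) :
  right_inverse (algAut_one E) (@algAut_inv F E) (@algAut_mul F E).
Proof. by move=> f; apply: val_inj; apply: lker0_compfV (algAut_lker0 f). Qed.

HB.instance Definition _ (F : fieldType) (E : commNaAlgType F) :=
  isGroup.Build (algAut E) (@algAut_mulA F E) (@algAut_mul1 F E)
    (@algAut_mulr1 F E) (@algAut_mulV F E) (@algAut_mulrV F E).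

Definition group_isomorphic (G H : groupType) : Prop :=
  exists phi : {multiplicative G -> H}, bijective phi.

(* Main.v *)
(* Take the basis indexed by G with e_h^2 = \sum_g c(h^-1 g) e_g, where c is
   injective on G and c(1) <> 0. If this algebra is idempotent, an automorphism
   sends e_g to lam_g e_(s g) for a permutation s. Comparing the coefficients
   of e_(s h) in the image of e_h^2 gives lam_h = 1; the other coefficients
   then give h^-1 g = (s h)^-1 (s g), i.e. s is a left translation of G. With
   c(1) = 1 and the other values of c distinct even numbers, the structure
   matrix is congruent to the identity modulo 2, hence is nonsingular in
   characteristic 0. *)
Require Import Defs.
From HB Require Import structures.
From mathcomp Require Import boolp.
From mathcomp Require Import all_boot all_order all_fingroup all_algebra.

Set Implicit Arguments.
Unset Strict Implicit.
Unset Printing Implicit Defensive.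

Import GRing.Theory.

Local Open Scope ring_scope.

(** * The evolution algebra of a matrix, on row vectors *)

Definition hadamard (F : fieldType) (n : nat) (x y : 'rV[F]_n) : 'rV[F]_n :=
  \row_i (x 0 i * y 0 i).

(* Row i of M lists the coordinates of the square of the i-th natural basis
   vector, so M is the transpose of the structure matrix. *)
Definition evoAlg (F : fieldType) (n : nat) (M : 'M[F]_n) : Type := 'rV[F]_n.

HB.instance Definition _ (F : fieldType) (n : nat) (M : 'M[F]_n) :=
  Vector.copy (evoAlg M) 'rV[F]_n.

Section EvoAlg.
Variables (F : fieldType) (n : nat) (M : 'M[F]_n).

Definition evo_mul (x y : evoAlg M) : evoAlg M := hadamard x y *m M.

Lemma evo_mulC : commutative evo_mul.
Proof.
move=> x y; congr (_ *m M); apply/rowP => i.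
by rewrite !mxE mulrC.
Qed.

Lemma evo_mulDl : left_distributive evo_mul +%R.
Proof.
move=> x y z; rewrite /evo_mul -mulmxDl; congr (_ *m M); apply/rowP => i.
by rewrite !mxE mulrDl.
Qed.

Lemma evo_mulZl (a : F) (x y : evoAlg M) :
  evo_mul (a *: x) y = a *: evo_mul x y.
Proof.
rewrite [RHS](scalemxAl a (hadamard x y) M); congr (_ *m M).
by apply/rowP => i; rewrite !mxE mulrA.
Qed.

HB.instance Definition _ := Vector_isCommNaAlg.Build F (evoAlg M)
  evo_mulC evo_mulDl evo_mulZl.

Definition evo_basis (i : 'I_n) : evoAlg M := delta_mx 0 i.

Lemma evo_basisE (i j : 'I_n) : evo_basis i 0 j = (j == i)%:R.
Proof. by rewrite mxE eqxx. Qed.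

Lemma evo_basis_inj : injective evo_basis.
Proof.
move=> i j /rowP/(_ i); rewrite !evo_basisE eqxx.
by case: eqVneq => // _ /eqP; rewrite oner_eq0.
Qed.

Lemma evo_scale_basisE (a : F) (i j : 'I_n) :
  (a *: evo_basis i) 0 j = a * (j == i)%:R.
Proof. by rewrite mxE evo_basisE. Qed.

Lemma evo_sum_basis (x : evoAlg M) : x = \sum_i x 0 i *: evo_basis i.
Proof. exact: (row_sum_delta x). Qed.

Lemma evo_mulE (x y : evoAlg M) (j : 'I_n) :
  (x ** y) 0 j = \sum_i x 0 i * y 0 i * M i j.
Proof. by rewrite mxE; apply: eq_bigr => i _; rewrite mxE. Qed.

Lemma evo_basis_sqr (i : 'I_n) : evo_basis i ** evo_basis i = row i M.
Proof.
apply/rowP => j; rewrite evo_mulE (bigD1 i) //= big1 => [|k ki].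
  by rewrite evo_basisE eqxx !mul1r addr0 mxE.
by rewrite evo_basisE (negbTE ki) !mul0r.
Qed.

Lemma evo_basis_mul (i j : 'I_n) : i != j -> evo_basis i ** evo_basis j = 0.
Proof.
move=> ij; apply/rowP => k; rewrite evo_mulE big1 ?mxE // => l _.
rewrite !evo_basisE; have [->|_] := eqVneq l i; last by rewrite !mul0r.
by rewrite (negbTE ij) mulr0 mul0r.
Qed.

Lemma evoAlg_evolution : evolution_algebra (evoAlg M).
Proof.
exists n, (mktuple evo_basis); split; last first.
  by move=> i j ij; rewrite !tnth_mktuple evo_basis_mul.
rewrite basisEdim; apply/andP; split; last first.
  by rewrite dimvf size_tuple /= /dim /= mul1n.
apply/subvP => x _; rewrite (evo_sum_basis x).
apply: memv_suml => i _; apply: memvZ; apply: memv_span.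
by apply/tnthP; exists i; rewrite tnth_mktuple.
Qed.

(** * Consequences of invertibility: idempotence and monomial automorphisms *)

Hypothesis M_unit : M \in unitmx.

(** The rows of [M] are the squares of the basis vectors, and they span since [v] is [v *m invmx M]
    times [M]. *)
Lemma evoAlg_idempotent : idempotent_algebra (evoAlg M).
Proof.
move=> v; exists [seq (evo_basis i, evo_basis i) | i <- enum 'I_n].
have -> : v = \sum_i (v *m invmx M) 0 i *: (evo_basis i ** evo_basis i).
  rewrite -[LHS](mulmxKV M_unit) [LHS]mulmx_sum_row.
  by apply: eq_bigr => i _; rewrite evo_basis_sqr.
apply: memv_suml => i _; apply: memvZ; apply: memv_span.
apply/mapP; exists (evo_basis i, evo_basis i) => //.
by apply: map_f; rewrite mem_enum.
Qed.

Lemma evo_mul_eq0 (x y : evoAlg M) :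
  x ** y = 0 -> forall i, (x 0 i == 0) || (y 0 i == 0).
Proof.
move=> xy0 i; rewrite -mulf_eq0.
have -> : x 0 i * y 0 i = hadamard x y 0 i by rewrite mxE.
by rewrite -[hadamard x y](mulmxK M_unit) [_ *m M]xy0 mul0mx mxE.
Qed.

(* Since M is invertible, x ** y = 0 forces disjoint supports, so the images
   of the basis vectors have pairwise disjoint nonempty supports, hence
   supports of size one. *)
Lemma evo_aut_monomial (f : 'End(evoAlg M)) : algebra_automorphism f ->
  exists (s : 'S_n) (lam : 'I_n -> F),
    [/\ forall i, lam i != 0,
        forall i, f (evo_basis i) = lam i *: evo_basis (s i)
      & forall i j, lam i ^+ 2 * M (s i) (s j) = M i j * lam j].
Proof.
case=> bf mf.
have nz i : exists k, f (evo_basis i) 0 k != 0.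
  apply/existsP; apply: contraT; rewrite negb_exists => /forallP z.
  have /(bij_inj bf) /rowP/(_ i) : f (evo_basis i) = f 0.
    by rewrite linear0; apply/rowP => k; rewrite mxE; apply/eqP/negPn.
  by rewrite evo_basisE eqxx mxE => /eqP; rewrite oner_eq0.
have disj i j k : i != j ->
    (f (evo_basis i) 0 k == 0) || (f (evo_basis j) 0 k == 0).
  move=> ij; apply: evo_mul_eq0.
  by rewrite -mf evo_basis_mul // linear0.
pose t i := xchoose (nz i).
have tP i : f (evo_basis i) 0 (t i) != 0 by exact: (xchooseP (nz i)).
have t_inj : injective t.
  move=> i j tij; apply/eqP; case: eqVneq => // /(disj i j (t i)).
  by rewrite {2}tij (negbTE (tP i)) (negbTE (tP j)).
pose s := perm t_inj; pose lam i := f (evo_basis i) 0 (s i).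
have lam0 i : lam i != 0 by rewrite /lam permE.
have fE i : f (evo_basis i) = lam i *: evo_basis (s i).
  apply/rowP => k; rewrite evo_scale_basisE.
  have [->|ki] := eqVneq k (s i); first by rewrite mulr1.
  (* Every index other than [s i] is some [s j] with [j != i]; there the image of the [j]-th basis
     vector is nonzero, so disjointness kills that of the [i]-th. *)
  rewrite mulr0; have [j kj] : exists j, k = s j.
    by exists (s^-1 k)%g; rewrite permKV.
  have /(disj i j k) : i != j by apply: contraNneq ki => ->; rewrite kj.
  by rewrite {2}kj (negbTE (lam0 j)) orbF => /eqP.
exists s, lam; split=> // i j.
(* Both sides of the relation are the coefficient at [s j] in the image of the square of the [i]-th
   basis vector. *)
have : f (evo_basis i ** evo_basis i) 0 (s j)
    = (f (evo_basis i) ** f (evo_basis i)) 0 (s j) by rewrite mf.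
rewrite [in RHS]fE evo_basis_sqr (evo_sum_basis (row i M)) linear_sum summxE.
rewrite (bigD1 j) //= big1 => [|k kj]; last first.
  rewrite linearZ /= fE scalerA evo_scale_basisE (inj_eq perm_inj).
  by rewrite eq_sym (negbTE kj) mulr0.
rewrite linearZ /= fE scalerA addr0 evo_scale_basisE eqxx mulr1 mxE => ->.
rewrite evo_mulE (bigD1 (s i)) //= big1 => [|k ki]; last first.
  by rewrite evo_scale_basisE (negbTE ki) !(mulr0, mul0r).
by rewrite evo_scale_basisE eqxx mulr1 addr0.
Qed.

(** * Automorphisms permuting the natural basis *)

Definition evo_perm (s : 'S_n) : 'End(evoAlg M) :=
  linfun (col_perm s^-1 : evoAlg M -> evoAlg M).

Lemma evo_permE (s : 'S_n) (x : evoAlg M) (j : 'I_n) :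
  evo_perm s x 0 j = x 0 (s^-1 j)%g.
Proof. by rewrite lfunE mxE. Qed.

(** This is why [evo_perm] uses the inverse: [col_perm s] would send the basis vector at [s i] to
    the one at [i]. *)
Lemma evo_perm_basis (s : 'S_n) (i : 'I_n) :
  evo_perm s (evo_basis i) = evo_basis (s i).
Proof.
apply/rowP => j; rewrite evo_permE !evo_basisE.
by rewrite (can2_eq (permKV s) (permK s)).
Qed.

Lemma evo_perm_aut (s : 'S_n) : (forall i j, M (s i) (s j) = M i j) ->
  algebra_automorphism (evo_perm s).
Proof.
move=> Ms; split.
  exists (evo_perm s^-1) => x; apply/rowP => j;
  by rewrite !evo_permE ?invgK ?permK ?permKV.
move=> x y; apply/rowP => j; rewrite evo_permE !evo_mulE.
rewrite [RHS](reindex_inj (@perm_inj _ s)); apply: eq_bigr => i _.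
by rewrite !evo_permE permK -Ms permKV.
Qed.

Lemma evo_eq_on_basis (f g : 'End(evoAlg M)) :
  (forall i, f (evo_basis i) = g (evo_basis i)) -> f = g.
Proof.
move=> fg; apply/lfunP => x; rewrite (evo_sum_basis x) !linear_sum.
by apply: eq_bigr => i _; rewrite !linearZ /= fg.
Qed.

End EvoAlg.

Lemma intr_eq0_pchar0 (R : fieldType) (z : int) :
  [pchar R] =i pred0 -> (z%:~R == 0 :> R) = (z == 0).
Proof.
move=> /pcharf0P charR0; case: z => m; first by rewrite -pmulrn charR0.
by rewrite NegzE mulrNz oppr_eq0 -pmulrn charR0.
Qed.

(** * Left translations as the full automorphism group *)

Section CayleyAlgebra.
Variables (F : fieldType) (G : finGroupType).

(** The entry type is arbitrary so that the matrix exists over both [int] and [F]. *)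
Definition cayley_mx (R : Type) (c : G -> R) : 'M[R]_#|G| :=
  \matrix_(i, j) c ((enum_val i)^-1 * enum_val j)%g.

Lemma left_mult_inj (k : G) :
  injective (fun i : 'I_#|G| => enum_rank (k * enum_val i)%g).
Proof. by move=> i j /enum_rank_inj/mulgI/enum_val_inj. Qed.

Definition left_mult (k : G) : 'S_#|G| := perm (@left_mult_inj k).

Lemma enum_val_left_mult (k : G) (i : 'I_#|G|) :
  enum_val (left_mult k i) = (k * enum_val i)%g.
Proof. by rewrite permE enum_rankK. Qed.

Lemma cayley_mx_left_mult (R : Type) (c : G -> R) (k : G) (i j : 'I_#|G|) :
  cayley_mx c (left_mult k i) (left_mult k j) = cayley_mx c i j.
Proof. by rewrite !mxE !enum_val_left_mult invMg -mulgA mulKg. Qed.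

Variable c : G -> F.

Let E := evoAlg (cayley_mx c).

Definition left_mult_aut (k : G) : algAut E :=
  AlgAut (asboolT (evo_perm_aut (cayley_mx_left_mult c k))).

Lemma left_mult_aut_basis (k : G) (i : 'I_#|G|) :
  left_mult_aut k (evo_basis _ i) = evo_basis _ (left_mult k i).
Proof. exact: evo_perm_basis. Qed.

Lemma left_mult_autM (k l : G) :
  left_mult_aut (k * l)%g = (left_mult_aut k * left_mult_aut l)%g.
Proof.
apply/val_inj/evo_eq_on_basis => i; rewrite comp_lfunE !left_mult_aut_basis.
by congr evo_basis; apply: enum_val_inj; rewrite !enum_val_left_mult mulgA.
Qed.

(** The translation by [k] is recovered from the image of the basis vector at the identity. *)
Lemma left_mult_aut_inj : injective left_mult_aut.
Proof.
move=> k l kl; have := left_mult_aut_basis k (enum_rank 1%g).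
rewrite kl left_mult_aut_basis => /evo_basis_inj/(congr1 enum_val).
by rewrite !enum_val_left_mult enum_rankK !mulg1.
Qed.

Hypotheses (c_inj : injective c) (c1 : c 1%g != 0).
Hypothesis cayley_unit : cayley_mx c \in unitmx.

Lemma left_mult_aut_surj (f : algAut E) : exists k, left_mult_aut k = f.
Proof.
have [s [lam [lam0 fE sE]]] := evo_aut_monomial cayley_unit (algAutP f).
(* The diagonal relation reads [lam i ^+ 2 * c 1 = c 1 * lam i], with both [c 1] and [lam i]
   cancellable. *)
have lam1 i : lam i = 1.
  have := sE i i; rewrite !mxE !mulVg mulrC => /(mulfI c1).
  by rewrite expr2 -[RHS]mulr1 => /(mulfI (lam0 i)).
pose i0 := enum_rank (1%g : G); exists (enum_val (s i0)).
apply/val_inj/evo_eq_on_basis => i.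
rewrite left_mult_aut_basis [RHS]fE lam1 scale1r.
congr evo_basis; apply: enum_val_inj; rewrite enum_val_left_mult.
(* The row of the identity suffices: injectivity of [c] determines [s i] from [s i0]. *)
have := sE i0 i; rewrite !lam1 expr1n mul1r mulr1 !mxE => /c_inj.
by rewrite enum_rankK invg1 mul1g => <-; rewrite mulKVg.
Qed.

Lemma algAut_cayley : group_isomorphic (algAut E) G.
Proof.
have [phi phiK] := choice left_mult_aut_surj.
(* A right inverse of an injective morphism is itself a morphism. *)
have phiM : {morph phi : f g / (f * g)%g}.
  by move=> f g; apply: left_mult_aut_inj; rewrite left_mult_autM !phiK.
pose phiMM := isMultiplicative.Build (algAut E) G phi phiM.
pose Phi : {multiplicative algAut E -> G} := HB.pack phi phiMM.
exists Phi; exists left_mult_aut => // k.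
by apply: left_mult_aut_inj; rewrite phiK.
Qed.

End CayleyAlgebra.

(** * An injective colouring with nonsingular matrix *)

Lemma map_cayley_mx (G : finGroupType) (R S : Type) (u : R -> S) (c : G -> R) :
  map_mx u (cayley_mx c) = cayley_mx (u \o c).
Proof. by apply/matrixP => i j; rewrite !mxE. Qed.

(** Ranks start at 0, so a nonidentity element may get colour 0; this is harmless, as 0 is even and
    taken at most once. *)
Definition colour (G : finGroupType) (g : G) : nat :=
  if g == 1%g then 1%N else (enum_rank g).*2.

Lemma colour_inj (G : finGroupType) : injective (@colour G).
Proof.
move=> g h; rewrite /colour.
case: eqP => [->|_]; case: eqP => [->|_] //.
- by move/(congr1 odd); rewrite odd_double.
- by move/(congr1 odd); rewrite odd_double.
- by move/double_inj/ord_inj/enum_rank_inj.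
Qed.

Lemma det_cayley_colour (G : finGroupType) :
  \det (cayley_mx (Posz \o @colour G)) != 0.
Proof.
apply: contraTneq isT => det0.
have := det_map_mx (intr : int -> 'F_2) (cayley_mx (Posz \o @colour G)).
suff -> : map_mx intr (cayley_mx (Posz \o @colour G)) = 1%:M :> 'M['F_2]_#|G|.
  by rewrite det1 det0 => /eqP; rewrite oner_eq0.
apply/matrixP => i j; rewrite !mxE /= /colour -pmulrn.
(* The identity colour 1 occurs exactly on the diagonal; all other entries are doubles, hence 0 in
   ['F_2]. *)
rewrite -(inj_eq (mulgI (enum_val i))) mulKVg mulg1 (inj_eq enum_val_inj).
rewrite eq_sym; case: eqP => // _.
by rewrite -mul2n natrM pchar_Zp // mul0r.
Qed.

Theorem theorem3p1 (F : fieldType) (charF0 : [pchar F] =i pred0)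
    (G : finGroupType) :
  exists E : commNaAlgType F,
    [/\ evolution_algebra E, idempotent_algebra E
      & group_isomorphic (algAut E) G].
Proof.
pose c (g : G) : F := (Posz (colour g))%:~R.
have unitM : cayley_mx c \in unitmx.
  (* The determinant over [F] is the image of the nonzero integer determinant. *)
  rewrite -[c]/(intr \o (Posz \o @colour G)) -map_cayley_mx.
  by rewrite unitmxE det_map_mx unitfE intr_eq0_pchar0 // det_cayley_colour.
exists (evoAlg (cayley_mx c)); split; first exact: evoAlg_evolution.
  exact: evoAlg_idempotent.
apply: algAut_cayley unitM; last by rewrite /c /colour eqxx oner_eq0.
move=> g h /eqP; rewrite -subr_eq0 -rmorphB /= intr_eq0_pchar0 //.
by rewrite subr_eq0 => /eqP[/colour_inj].
Qed.
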